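(* Let $(a_g)$ be a sequence of complex numbers indexed by monic polynomials $g\in\mathbb{F}_q[t]$, and let $D,Q,N\in\mathbb{N}$. Then $$\sum_{\substack{D<\deg(f)\le Q\\ f\ \text{monic}}}\frac{1}{\phi(f)}\ \sum_{\substack{\chi \bmod f\\ \chi\ \text{primitive}}}\ \Bigl|\sum_{\deg(g)\le N}a_g\chi(g)\Bigr|^2\ll\left(q^{N-D}+q^{Q}\right)\sum_{\deg(g)\le N}|a_g|^2,$$ where the sum over $\chi$ runs over the primitive characters $\chi$ modulo $f$.
   Context: $q$ is a fixed prime power; the implied constant does not depend on $D,Q,N$ or $(a_g)$ (it may depend on $q$). $\phi(f)=\#(\mathbb{F}_q[t]/(f))^{*}$. The polynomials $g$ in the sums are monic. A (multiplicative) character modulo $f$ is a character of $(\mathbb{F}_q[t]/(f))^{*}$, extended to $\mathbb{F}_q[t]$ by $\chi(g)=\chi(g\bmod f)$ if $(g,f)=1$ and $\chi(g)=0$ otherwise. It is primitive if there is no $d\mid f$ with $(d)\ne(f)$ such that $\chi$ is induced by a character modulo $d$. *)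

(* Defs.v *)
From HB Require Import structures.
From mathcomp Require Import all_boot all_order all_algebra all_fingroup all_solvable all_field.
From mathcomp Require Import all_classical all_reals.
From mathcomp.real_closed Require Export complex.
Set Implicit Arguments.
Unset Strict Implicit.
Unset Printing Implicit Defensive.
Import Order.TTheory GRing.Theory Num.Theory.
Local Open Scope classical_set_scope.
Local Open Scope ring_scope.

(* {poly %/ f} is F[t]/(f) only when f is monic of positive degree; otherwise
   the library silently replaces f by 'X. Every use below is guarded: the
   moduli of the large sieve have positive degree, and the zero ring
   F[t]/(1) is treated separately in [char_on_poly]. *)
Definition residue_units (F : finFieldType) (f : {poly F}) : finGroupType :=
  {unit {poly %/ f}}.

Definition euler_phi (F : finFieldType) (f : {poly F}) : nat :=
  #|residue_units f|.

(* The two clauses force nonzero values: these are the morphisms G -> C^*. *)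
Definition group_char (R : realType) (G : finGroupType)
    (chi : {ffun G -> R[i]}) : Prop :=
  chi 1%g = 1 /\ forall x y, chi (x * y)%g = chi x * chi y.

(* [insub] is [Some] exactly when g mod f is a unit, i.e. when f and g are
   coprime, see [char_ext_neq0]. *)
Definition char_ext (R : realType) (F : finFieldType) (f : {poly F})
    (chi : {ffun residue_units f -> R[i]}) (g : {poly F}) : R[i] :=
  if (insub (in_qpoly f g) : option {unit {poly %/ f}}) is Some u
  then chi u else 0.

(* For d = 1 the unit group of the zero ring is trivial and every polynomial
   is coprime to 1, so the only extended character is the constant 1. *)
Definition char_on_poly (R : realType) (F : finFieldType) (d : {poly F})
    (xi : {poly F} -> R[i]) : Prop :=
  if d == 1 then forall g, xi g = 1
  else exists2 psi : {ffun residue_units d -> R[i]},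
         group_char psi & forall g, xi g = char_ext psi g.

Definition induced_from (R : realType) (F : finFieldType) (f d : {poly F})
    (chi : {ffun residue_units f -> R[i]}) : Prop :=
  exists2 xi : {poly F} -> R[i],
    char_on_poly d xi & forall g, coprimep g f -> char_ext chi g = xi g.

(* The divisors d of f matter only through the ideal (d), so they are taken
   monic. *)
Definition primitive_char (R : realType) (F : finFieldType) (f : {poly F})
    (chi : {ffun residue_units f -> R[i]}) : Prop :=
  group_char chi /\
  ~ exists d : {poly F}, [/\ d \is monic, d %| f, d != f & induced_from d chi].

Definition primitive_chars (R : realType) (F : finFieldType) (f : {poly F}) :
    set {ffun residue_units f -> R[i]} :=
  [set chi | primitive_char chi].

Section CharacterFacts.
Variables (R : realType) (F : finFieldType) (f : {poly F}).

Lemma group_char_neq0 (G : finGroupType) (chi : {ffun G -> R[i]}) x :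
  group_char chi -> chi x != 0.
Proof.
move=> [chi1 chiM]; apply/eqP => chix0.
by have := chiM x x^-1%g; rewrite mulgV chi1 chix0 mul0r => /eqP; rewrite oner_eq0.
Qed.

Lemma char_ext_neq0 (chi : {ffun residue_units f -> R[i]}) (g : {poly F}) :
  f \is monic -> (1 < size f)%N -> group_char chi ->
  (char_ext chi g != 0) = coprimep f g.
Proof.
move=> fmon fsz chiP.
have -> : coprimep f g = (in_qpoly f g \is a GRing.unit).
  rewrite qualifE /= /in_qpoly /= /mk_monic fsz fmon /=.
  by rewrite -Pdiv.IdomainMonic.modpE // coprimep_modr.
rewrite /char_ext; case: insubP => [u gu _|/negPf ->]; last by rewrite eqxx.
by rewrite gu; apply: group_char_neq0.
Qed.

(* The finitely supported sum over [primitive_chars] therefore ranges over all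
   of them. *)
Lemma finite_primitive_chars : finite_set (@primitive_chars R F f).
Proof.
set n := #|residue_units f|.
have [s sE] := closed_field_poly_normal ('X^n - 1 : {poly R[i]}).
apply: (@sub_finite_set _ _ ((fun h : {ffun residue_units f -> seq_sub s} =>
  [ffun x => ssval (h x)]) @` setT)); last first.
  by apply: finite_image; exact: finite_finset.
move=> chi [[chi1 chiM] _] /=.
have chis x : chi x \in s.
  have chiX m : chi (x ^+ m)%g = chi x ^+ m.
    by elim: m => [|m IHm]; rewrite ?expg0 ?expr0 // expgS exprS chiM IHm.
  have n_gt0 : (0 < n)%N by apply/card_gt0P; exists 1%g.
  have : root ('X^n - 1 : {poly R[i]}) (chi x).
    rewrite rootE !hornerE -chiX.
    have -> : (x ^+ n = 1)%g by apply/eqP; rewrite -order_dvdn /n -cardsT order_dvdG ?inE.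
    by rewrite chi1 subrr.
  by rewrite sE lead_coefDl ?lead_coefXn ?scale1r ?root_prod_XsubC //
    size_polyXn size_polyN size_poly1 ltnS.
exists [ffun x => SeqSub (chis x)] => //.
by apply/ffunP => x; rewrite !ffunE.
Qed.
End CharacterFacts.

(* Main.v *)
(* For a fixed degree k of the modulus, distinct primitive characters, of the
   same or of different moduli of degree k, are pairwise orthogonal on the space
   of all polynomials of degree < M as soon as M >= 2k: for two moduli f, f' the
   product of one character with the conjugate of the other is periodic modulo
   f f', so its sum vanishes unless the characters agree on all polynomials
   prime to f f', and then both are induced from gcd(f, f'). The squared norm
   of such a character is q^(M-k) phi(f). Hence Bessel's inequality, applied
   with M = max(N+1, 2k) to the sequence a extended by zero, bounds the
   contribution of the moduli of degree k by (q^(N+1-k) + q^k) |a|^2; neither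
   Gauss sums nor additive characters are needed. Summing the two geometric
   progressions over D < k <= Q gives the theorem with the constant q + 2. *)

Require Import Defs.
From HB Require Import structures.
From mathcomp Require Import all_boot all_order all_algebra all_fingroup all_solvable all_field.
From mathcomp Require Import all_classical all_reals.
From mathcomp.real_closed Require Import complex.
From mathcomp Require Import ring lra.
Set Implicit Arguments.
Unset Strict Implicit.
Unset Printing Implicit Defensive.
Import Order.TTheory GRing.Theory Num.Theory.
Local Open Scope ring_scope.

(** * Bessel's inequality for orthogonal families that need not be normalised *)

Section Bessel.
Variables (C : numClosedFieldType) (T : finType).
Implicit Types u v : T -> C.

Definition dotf u v : C := \sum_x u x * (v x)^*.

Lemma dotf_conj u v : (dotf u v)^* = dotf v u.
Proof.
by rewrite /dotf rmorph_sum; apply: eq_bigr => x _; rewrite rmorphM /= conjCK mulrC.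
Qed.

Lemma dotfBl u v w c : dotf (fun x => u x - c * v x) w = dotf u w - c * dotf v w.
Proof.
rewrite /dotf mulr_sumr -sumrB; apply: eq_bigr => x _.
by rewrite mulrBl mulrA.
Qed.

Lemma dotfBr u v w c :
  dotf w (fun x => u x - c * v x) = dotf w u - c^* * dotf w v.
Proof. by rewrite -dotf_conj dotfBl rmorphB rmorphM /= !dotf_conj. Qed.

Lemma dotf_ge0 u : 0 <= dotf u u.
Proof. by apply: sumr_ge0 => x _; rewrite mul_conjC_ge0. Qed.

(** Induction on [s]: subtracting from [u] its projection onto [v i] leaves the products with the
    later vectors unchanged, by orthogonality, and lowers the squared norm by exactly the term of
    [i]. *)
Lemma bessel (I : eqType) (s : seq I) (v : I -> T -> C) (u : T -> C) :
  uniq s -> {in s, forall i, dotf (v i) (v i) != 0} ->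
  {in s &, forall i j, i != j -> dotf (v i) (v j) = 0} ->
  \sum_(i <- s) `|dotf u (v i)| ^+ 2 / dotf (v i) (v i) <= dotf u u.
Proof.
elim: s u => [|i s IHs] u; first by rewrite big_nil dotf_ge0.
move=> /= /andP[is_ s_uniq] v0 vorth.
set n := dotf (v i) (v i); set c := dotf u (v i) / n.
have n0 : n != 0 by apply: v0; rewrite mem_head.
pose w x := u x - c * v i x.
have wv j : j \in s -> dotf w (v j) = dotf u (v j).
  move=> js; rewrite dotfBl vorth ?mulr0 ?subr0 ?mem_head ?inE ?js ?orbT //.
  by apply: contraNneq is_ => ->.
have wvi : dotf w (v i) = 0 by rewrite dotfBl -/n /c divfK // subrr.
have wE : dotf w w = dotf u u - `|dotf u (v i)| ^+ 2 / n.
  rewrite dotfBr wvi mulr0 subr0 dotfBl -[dotf (v i) u]dotf_conj normCK /c.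
  by congr (_ - _); rewrite mulrAC.
have ss : {subset s <= i :: s} by move=> j js; rewrite inE js orbT.
have := IHs w s_uniq (sub_in1 ss v0) (sub_in2 ss vorth).
rewrite wE lerBrDl big_cons; apply: le_trans; rewrite lerD2l le_eqVlt.
by apply/orP/or_introl/eqP/eq_big_seq => j js; rewrite wv.
Qed.

End Bessel.

(** * Characters extended to polynomials *)

(** The value at [x] is a root of unity, since [x] has finite order. *)
Lemma norm_group_char (R : realType) (G : finGroupType) (chi : {ffun G -> R[i]}) x :
  group_char chi -> `|chi x| = 1.
Proof.
move=> [chi1 chiM]; have chiX m : chi (x ^+ m)%g = chi x ^+ m.
  by elim: m => [|m IHm]; rewrite ?expg0 ?expr0 // expgS exprS chiM IHm.
have := congr1 Num.norm (chiX #[x]%g).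
rewrite expg_order chi1 normr1 normrX => /esym/eqP.
by rewrite pexpr_eq1 ?order_gt0 // => /eqP.
Qed.

Section ExtendedCharacters.
Variables (R : realType) (F : finFieldType) (f : {poly F}).
Hypotheses (fmon : f \is monic) (fsz : (1 < size f)%N).
Implicit Types (chi : {ffun residue_units f -> R[i]}) (g h : {poly F}).

Lemma mk_monicE : mk_monic f = f.
Proof. by rewrite /mk_monic fsz fmon. Qed.

Lemma in_qpoly_eqP g h : (in_qpoly f g == in_qpoly f h) = (f %| g - h).
Proof.
rewrite -subr_eq0 -raddfB -val_eqE /= mk_monicE.
by rewrite -Pdiv.IdomainMonic.modpE.
Qed.

Lemma in_qpoly_unit g : (in_qpoly f g \is a GRing.unit) = coprimep f g.
Proof.
by rewrite qualifE /= mk_monicE -Pdiv.IdomainMonic.modpE // coprimep_modr.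
Qed.

Lemma char_extE chi (u : residue_units f) g :
  in_qpoly f g = val u -> char_ext chi g = chi u.
Proof. by move=> gu; rewrite /char_ext gu valK. Qed.

Lemma residue_of_coprime g :
  coprimep f g -> exists u : residue_units f, in_qpoly f g = val u.
Proof.
rewrite -in_qpoly_unit => gU.
by exists (FinRing.Unit gU).
Qed.

Lemma in_qpoly_val (u : residue_units f) : in_qpoly f (val (val u)) = val u.
Proof.
by apply: val_inj; rewrite /= Pdiv.Ring.rmodp_small ?size_mk_monic.
Qed.

Lemma residue_coprime (u : residue_units f) : coprimep f (val (val u)).
Proof. by rewrite -in_qpoly_unit in_qpoly_val (valP u). Qed.

Lemma char_ext_residue chi (u : residue_units f) :
  char_ext chi (val (val u)) = chi u.
Proof. by apply: char_extE; rewrite in_qpoly_val. Qed.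

Lemma char_ext_eqmod chi g h : f %| g - h -> char_ext chi g = char_ext chi h.
Proof. by rewrite -in_qpoly_eqP /char_ext => /eqP ->. Qed.

Lemma char_ext_eq0 chi g :
  group_char chi -> (char_ext chi g == 0) = ~~ coprimep f g.
Proof. by move=> chiP; rewrite -(char_ext_neq0 _ fmon fsz chiP) negbK. Qed.

Lemma char_ext1 chi : group_char chi -> char_ext chi 1 = 1.
Proof.
case=> chi1 _; rewrite (@char_extE _ 1%g) //.
by apply: val_inj; rewrite in_qpoly1.
Qed.

Lemma char_extM chi g h :
  group_char chi -> char_ext chi (g * h) = char_ext chi g * char_ext chi h.
Proof.
move=> chiP; have [gC|gN] := boolP (coprimep f g); last first.
  have /eqP -> : char_ext chi g == 0 by rewrite char_ext_eq0.
  by apply/eqP; rewrite mul0r char_ext_eq0 // coprimepMr negb_and gN.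
have [hC|hN] := boolP (coprimep f h); last first.
  have /eqP -> : char_ext chi h == 0 by rewrite char_ext_eq0.
  by apply/eqP; rewrite mulr0 char_ext_eq0 // coprimepMr negb_and hN orbT.
have [[u gu] [v hv]] := (residue_of_coprime gC, residue_of_coprime hC).
rewrite (char_extE _ gu) (char_extE _ hv) (@char_extE _ (u * v)%g).
  by case: chiP.
by rewrite rmorphM /= gu hv.
Qed.

Lemma norm_char_ext chi g : group_char chi -> `|char_ext chi g| = (coprimep f g)%:R.
Proof.
move=> chiP; have [gC|gN] := boolP (coprimep f g); last first.
  by apply/eqP; rewrite normr_eq0 char_ext_eq0.
by have [u gu] := residue_of_coprime gC; rewrite (char_extE _ gu) norm_group_char.
Qed.

Lemma char_ext_inj chi chi' :
  (forall g, coprimep f g -> char_ext chi g = char_ext chi' g) -> chi = chi'.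
Proof.
move=> eq_ext; apply/ffunP => u.
by rewrite -!char_ext_residue eq_ext // residue_coprime.
Qed.

End ExtendedCharacters.

(** * Polynomial gcds and coprime representatives of residues *)

Section PolynomialCongruences.
Variable F : fieldType.
Implicit Types d f g h u v : {poly F}.

Lemma coprimep_eqmod f g h : f %| g - h -> coprimep f g = coprimep f h.
Proof.
move=> /dvdpP[q gh]; rewrite -(coprimep_addl_mul q h f) -gh.
by rewrite subrK.
Qed.

(** The gcd is normalised because primitivity is tested on monic divisors; [Bezoutp] reaches the gcd
    [e] only up to a constant [c], whence the scaling by the inverse of [c * lead_coef e]. *)
Lemma monic_bezout f g : f != 0 ->
  exists d x y, [/\ d \is monic, d %| f, d %| g & d = x * f + y * g].
Proof.
move=> f0; have [[x y] /= ] := Bezoutp f g.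
set e := gcdp f g => /eqpf_eq[c c0 xyE].
have e0 : e != 0 by rewrite gcdp_eq0 negb_and f0.
have le0 : lead_coef e != 0 by rewrite lead_coef_eq0.
exists ((lead_coef e)^-1 *: e), ((c * lead_coef e)^-1 *: x).
exists ((c * lead_coef e)^-1 *: y).
rewrite !dvdpZl ?invr_eq0 // dvdp_gcdl dvdp_gcdr; split=> //.
  by rewrite monicE lead_coefZ mulVf.
by rewrite -!scalerAl -scalerDr xyE scalerA invfM mulrAC mulVf // mul1r.
Qed.

(* The summand d * gdcop u f is divisible by d and by the primes of f that do
   not divide u, and by no prime dividing u. *)
Definition coprime_lift d f u := u + d * gdcop u f.

Lemma coprime_liftP d f u :
  f != 0 -> d %| f -> coprimep d u -> coprimep f (coprime_lift d f u).
Proof.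
move=> f0 df du; set h := coprime_lift d f u; set s := gdcop u f.
have su : coprimep s u by apply: coprimep_gdco.
have hu : coprimep h u.
  rewrite coprimep_sym /h /coprime_lift addrC -[X in _ + X]mul1r addrC.
  by rewrite coprimep_addl_mul coprimepMr ![coprimep u _]coprimep_sym du su.
(* If [u] is 0, being coprime to [u] already makes [h] a nonzero constant. *)
have [u0|u0] := eqVneq u 0.
  by move: hu; rewrite u0 coprimep0 => /eqp_coprimepr ->; rewrite coprimep1.
have hs : coprimep h s.
  by rewrite coprimep_sym /h /coprime_lift addrC coprimep_addl_mul.
(* [f] divides the product of [s] and a power of [u], and [h] is prime to both. *)
rewrite coprimep_sym; apply: (coprimep_dvdl (dvdp_gdcor f u0)).
by rewrite coprimepMr hs coprimep_expr.
Qed.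

Lemma coprime_lift_eqmod d f u : d %| coprime_lift d f u - u.
Proof. by rewrite /coprime_lift addrAC subrr add0r dvdp_mulr. Qed.

End PolynomialCongruences.

(** * Descent of a character to a divisor of its modulus *)

Section Conductor.
Variables (R : realType) (F : finFieldType) (f d : {poly F}).
Hypotheses (fmon : f \is monic) (fsz : (1 < size f)%N).
Hypotheses (dmon : d \is monic) (df : d %| f).
Variable chi : {ffun residue_units f -> R[i]}.
Hypothesis chiP : group_char chi.
Hypothesis chi_ker :
  forall g, coprimep f g -> d %| g - 1 -> char_ext chi g = 1.

Let f0 : f != 0. Proof. exact: monic_neq0. Qed.

(** With [y] an inverse of [h] modulo [f], both [g * y] and [h * y] are 1 modulo [d], so the
    character is 1 on both, and its nonzero value at [y] cancels. *)
Lemma char_ext_eqmod_ker g h : coprimep f g -> coprimep f h -> d %| g - h ->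
  char_ext chi g = char_ext chi h.
Proof.
move=> fg fh dgh; have [[x y] /= xy1] := Bezout_eq1_coprimepP _ _ fh.
have fy : coprimep f y.
  by apply/Bezout_eq1_coprimepP; exists (x, h); rewrite /= -xy1 [h * y]mulrC.
have hy1 : d %| h * y - 1.
  have -> : h * y - 1 = - x * f by rewrite -xy1; ring.
  exact: dvdp_mull.
have gy1 : d %| g * y - 1.
  have -> : g * y - 1 = y * (g - h) + (h * y - 1) by ring.
  by rewrite dvdp_add // dvdp_mull.
have y0 : char_ext chi y != 0 by rewrite char_ext_neq0.
apply: (mulIf y0); rewrite -!char_extM //.
by rewrite !chi_ker // coprimepMr ?fg ?fh fy.
Qed.

(** A representative of a unit modulo [d] may share a factor with [f], so the character [psi] modulo
    [d] is read off at a lift prime to [f]. By [char_ext_eqmod_ker] the choice of lift does not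
    affect the value, which gives multiplicativity. *)
Lemma induced_from_ker : induced_from d chi.
Proof.
have [d1|d1] := eqVneq d 1.
  exists (fun=> 1); first by rewrite /char_on_poly d1 eqxx.
  by move=> g gf; apply: chi_ker; rewrite ?d1 ?dvd1p // coprimep_sym.
have dsz : (1 < size d)%N.
  rewrite ltnNge; apply: contraNN d1 => /size1_polyC dC.
  by move: dmon; rewrite dC monicE lead_coefC => /eqP ->.
pose psi : {ffun residue_units d -> R[i]} :=
  [ffun u : residue_units d => char_ext chi (coprime_lift d f (val (val u)))].
have lift_coprime u : coprimep f (coprime_lift d f (val (val (u : residue_units d)))).
  by apply: coprime_liftP => //; apply: residue_coprime.
have psiE (u : residue_units d) g : coprimep f g -> in_qpoly d g = val u ->
    psi u = char_ext chi g.
  move=> fg gu; rewrite ffunE; apply: char_ext_eqmod_ker => //.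
  have dgu : d %| val (val u) - g.
    by rewrite -in_qpoly_eqP // in_qpoly_val // gu.
  rewrite -[_ - g](subrKA (val (val u))).
  by rewrite dvdp_add // coprime_lift_eqmod.
have lift_residue (u : residue_units d) :
    in_qpoly d (coprime_lift d f (val (val u))) = val u.
  rewrite -[RHS]in_qpoly_val //; apply/eqP.
  by rewrite in_qpoly_eqP // coprime_lift_eqmod.
exists (char_ext psi).
  rewrite /char_on_poly (negPf d1); exists psi => //; split=> [|u v].
    by rewrite (psiE _ 1) ?coprimep1 ?char_ext1 ?in_qpoly1.
  rewrite [psi u]ffunE [psi v]ffunE -char_extM //; apply: psiE.
    by rewrite coprimepMr !lift_coprime.
  by rewrite rmorphM /= !lift_residue.
move=> g gf; have fg : coprimep f g by rewrite coprimep_sym.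
have [u gu] := residue_of_coprime dmon dsz (coprimep_dvdr df fg).
by rewrite (char_extE _ gu) (psiE u g).
Qed.

End Conductor.

(** * Primitive characters that agree on common units *)

Section PrimitivePairs.
Variables (R : realType) (F : finFieldType) (f f' : {poly F}).
Hypotheses (fmon : f \is monic) (fsz : (1 < size f)%N).
Hypotheses (f'mon : f' \is monic) (f'sz : (1 < size f')%N).
Variables (chi : {ffun residue_units f -> R[i]}).
Variables (chi' : {ffun residue_units f' -> R[i]}).
Hypotheses (chiP : primitive_char chi) (chi'P : group_char chi').

(** Let [d] be the monic gcd of [f] and [f']. For [g] prime to [f] and 1 modulo [d], some [g']
    satisfies [chi(g) = chi(g') = chi'(g') = 1]. So [chi] is induced from [d], and primitivity
    forces [d = f]. *)
Lemma primitive_agree_dvdp :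
  (forall g, coprimep f g -> coprimep f' g -> char_ext chi g = char_ext chi' g) ->
  f %| f'.
Proof.
move=> agree; have [chiG chiN] := chiP.
have [d [x [y [dmon df df' dE]]]] := monic_bezout f' (monic_neq0 fmon).
have [<- //|dNf] := eqVneq d f.
case: chiN; exists d; split=> //; apply: induced_from_ker => // g fg /dvdpP[w gE].
(* By the Chinese remainder theorem, g is congruent mod f to some g' = 1 mod f'. *)
pose g' := 1 + w * y * f'.
have gg' : f %| g - g'.
  have -> : g - g' = w * x * f by rewrite -(subrK 1 g) gE dE /g'; ring.
  exact: dvdp_mull.
have fg' : coprimep f g' by rewrite -(coprimep_eqmod gg').
have g'1 : f' %| g' - 1 by rewrite /g' addrAC subrr add0r dvdp_mull.
have f'g' : coprimep f' g' by rewrite (coprimep_eqmod g'1) coprimep1.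
rewrite (char_ext_eqmod fmon fsz chi gg') agree //.
by rewrite (char_ext_eqmod f'mon f'sz chi' g'1) char_ext1.
Qed.

End PrimitivePairs.

(** * Sums, counts and norms over polynomials of bounded degree *)

(** Multiplication by [u] raises degrees, so [t] multiplies only the remainder modulo [m] and keeps
    the quotient. This permutes the polynomials of degree below [M], remainders having degree below
    [deg m <= M]. Hence the sum equals [w u] times itself. *)
Lemma sum_npoly_twist (C : idomainType) (F : finFieldType) (m : {poly F}) M
    (w : {poly F} -> C) (u : {poly F}) :
  m != 0 -> (size m <= M.+1)%N ->
  (forall g h, m %| g - h -> w g = w h) ->
  coprimep m u -> (forall g, w (u * g) = w u * w g) -> w u != 1 ->
  \sum_(g : {poly_M F}) w (val g) = 0.
Proof.
move=> m0 mM w_per mu wM wu1.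
pose t (g : {poly F}) := g %/ m * m + (u * g) %% m.
have t_mod g : m %| t g - u * g.
  rewrite /t {2}(divp_eq (u * g) m) opprD addrACA subrr addr0 -mulrBl.
  exact: dvdp_mull.
have t_size (g : {poly F}) : (size g <= M)%N -> (size (t g) <= M)%N.
  have smod (h : {poly F}) : (size (h %% m)%R <= M)%N.
    by rewrite -ltnS (leq_trans _ mM) // ltn_modp.
  move=> gM; rewrite (leq_trans (size_polyD _ _)) // geq_max smod andbT.
  have -> : g %/ m * m = g - g %% m by apply/eqP; rewrite eq_sym subr_eq -divp_eq.
  by rewrite (leq_trans (size_polyD _ _)) // geq_max size_polyN smod gM.
pose T (g : {poly_M F}) : {poly_M F} := npolyp M (t (val g)).
have TE g : val (T g) = t (val g) by rewrite /= npolypK // t_size // size_npoly.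
have T_inj : injective T.
  move=> g h /(congr1 val); rewrite !TE => gh; apply: val_inj.
  have sm (k : {poly F}) : (size ((u * k) %% m)%R < size m)%N by rewrite ltn_modp.
  have qgh : val g %/ m = val h %/ m.
    have := congr1 (fun k => k %/ m) gh.
    by rewrite /t !divp_addl_mul_small.
  have : m %| u * val g - u * val h.
    have -> : u * val g - u * val h =
        (t (val h) - u * val h) - (t (val g) - u * val g) by rewrite gh; ring.
    exact: dvdp_sub.
  rewrite -mulrBr Gauss_dvdpr // => /modp_eq0P; rewrite modpD modpN => /eqP.
  rewrite subr_eq0 => /eqP rgh.
  by rewrite (divp_eq (val g) m) (divp_eq (val h) m) qgh rgh.
have : \sum_(g : {poly_M F}) w (val g) = w u * \sum_(g : {poly_M F}) w (val g).
  rewrite [LHS](reindex_inj T_inj) mulr_sumr; apply: eq_bigr => g _.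
  by rewrite TE (w_per _ _ (t_mod _)) wM.
move=> /eqP; rewrite eq_sym -subr_eq0 -[X in _ - X]mul1r -mulrBl mulf_eq0.
by rewrite subr_eq0 (negPf wu1) => /eqP.
Qed.

Lemma sum_npoly_widen (V : nmodType) (F : finFieldType) n M
    (P : pred {poly F}) (G : {poly F} -> V) : (n <= M)%N ->
  \sum_(g : {poly_n F} | P (val g)) G (val g) =
  \sum_(g : {poly_M F} | (size (val g) <= n)%N && P (val g)) G (val g).
Proof.
move=> nM; have wK (g : {poly_n F}) : val (npolyp M (val g)) = val g.
  by rewrite /= npolypK // (leq_trans (size_npoly g)).
rewrite [RHS](reindex_onto (fun g : {poly_n F} => npolyp M (val g))
  (fun g => npolyp n (val g))) => [|g /andP[gn _]]; last first.
  by apply: val_inj; rewrite /= npolypK npolypK ?gn // (leq_trans gn).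
apply: eq_big => g; last by rewrite wK.
by rewrite !wK size_npoly /= -val_eqE /= npolypK ?size_npoly // eqxx andbT.
Qed.

(** Such a [g] is determined by its quotient by [f], of degree below [M - k], and its residue, which
    is a unit. *)
Lemma card_npoly_coprime (F : finFieldType) (f : {poly F}) k M :
  f \is monic -> size f = k.+1 -> (0 < k)%N ->
  (#|[pred g : {poly_M F} | coprimep f (val g)]| <= #|F| ^ (M - k) * euler_phi f)%N.
Proof.
move=> fmon fk k_gt0; have fsz : (1 < size f)%N by rewrite fk ltnS.
(* The default [1%g] is used only for [g] not prime to [f], which are not counted. *)
pose t (g : {poly_M F}) : {poly_(M - k) F} * residue_units f :=
  (npolyp _ (val g %/ f), insubd (1%g : residue_units f) (in_qpoly f (val g))).
have t1E (g : {poly_M F}) : val (t g).1 = val g %/ f.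
  by rewrite /= npolypK // size_divp ?monic_neq0 // fk /= leq_sub2r.
have t2E (g : {poly_M F}) : coprimep f (val g) -> val (t g).2 = in_qpoly f (val g).
  by move=> fg; rewrite /t val_insubd in_qpoly_unit ?fg.
have t_inj : {in [pred g : {poly_M F} | coprimep f (val g)] &, injective t}.
  move=> g h; rewrite !inE => fg fh gh; apply: val_inj.
  have := t1E g; rewrite gh t1E => qE.
  have := t2E g fg; rewrite gh t2E // => /esym/eqP.
  rewrite in_qpoly_eqP // => /modp_eq0P; rewrite modpD modpN => /eqP.
  rewrite subr_eq0 => /eqP rE.
  by rewrite (divp_eq (val g) f) (divp_eq (val h) f) qE rE.
by rewrite -(card_in_imset t_inj) (leq_trans (max_card _)) // card_prod card_npoly.
Qed.

(* The conjugate makes the character sum of a the scalar product of a with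
   this vector. *)
Definition conj_char (R : realType) (F : finFieldType) M (f : {poly F})
    (chi : {ffun residue_units f -> R[i]}) (g : {poly_M F}) : R[i] :=
  (char_ext chi (val g))^*.

Lemma dotf_conj_char (R : realType) (F : finFieldType) M (f : {poly F})
    (chi : {ffun residue_units f -> R[i]}) :
  f \is monic -> (1 < size f)%N -> group_char chi ->
  dotf (@conj_char R F M f chi) (conj_char chi) =
  #|[pred g : {poly_M F} | coprimep f (val g)]|%:R.
Proof.
move=> fmon fsz chiP.
rewrite /dotf -sum1_card natr_sum [RHS]big_mkcond; apply: eq_bigr => g _.
rewrite /conj_char -normCK norm_conjC norm_char_ext // inE.
by case: coprimep; rewrite ?expr1n ?expr0n.
Qed.

(** * Orthogonality and the large sieve for moduli of one degree *)

(** Tagging with the modulus makes characters of different moduli comparable. Either a common unit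
    [u] separates them and the twist by [u] kills the sum, or they agree on all common units and
    coincide. The bound [k.*2 <= M] says that the period [f * f'] has degree at most [M]. *)
Lemma primitive_chars_orthogonal (R : realType) (F : finFieldType) k M
    (f f' : {poly F}) (chi : {ffun residue_units f -> R[i]})
    (chi' : {ffun residue_units f' -> R[i]}) :
  (0 < k)%N -> (k.*2 <= M)%N ->
  f \is monic -> f' \is monic -> size f = k.+1 -> size f' = k.+1 ->
  primitive_char chi -> primitive_char chi' ->
  Tagged (fun h => {ffun residue_units h -> R[i]}) chi <>
    Tagged (fun h => {ffun residue_units h -> R[i]}) chi' ->
  dotf (@conj_char R F M f chi) (conj_char chi') = 0.
Proof.
move=> k_gt0 kM fmon f'mon fk f'k chiP chi'P neq.
have fsz : (1 < size f)%N by rewrite fk ltnS.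
have f'sz : (1 < size f')%N by rewrite f'k ltnS.
have [chiG _] := chiP; have [chi'G _] := chi'P.
have [[u [fu f'u xu]]|noU] := pselect (exists u,
    [/\ coprimep f u, coprimep f' u & char_ext chi u != char_ext chi' u]).
  pose w g := (char_ext chi g)^* * char_ext chi' g.
  transitivity (\sum_(g : {poly_M F}) w (val g)).
    by apply: eq_bigr => g _; rewrite /conj_char conjCK.
  apply: (@sum_npoly_twist _ _ (f * f') _ _ u).
  - by rewrite mulf_neq0 ?monic_neq0.
  - by rewrite size_mul ?monic_neq0 // fk f'k addSn addnS addnn ltnS.
  - move=> g h ffgh; rewrite /w (@char_ext_eqmod _ _ f _ _ _ g h) //; last first.
      exact: dvdp_trans (dvdp_mulr _ (dvdpp _)) ffgh.
    rewrite (@char_ext_eqmod _ _ f' _ _ _ g h) //.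
    exact: dvdp_trans (dvdp_mull _ (dvdpp _)) ffgh.
  - by rewrite coprimepMl fu f'u.
  - by move=> g; rewrite /w !char_extM // rmorphM /= mulrACA.
  (* As [chi] has absolute value 1 at [u], [w u = 1] would make the two values at [u] equal. *)
  apply: contraNneq xu => /(congr1 (fun z => char_ext chi u * z)).
  rewrite mulrA mulr1 -normCK norm_char_ext // fu expr1n mul1r => ->.
  by [].
case: neq.
have agree g : coprimep f g -> coprimep f' g -> char_ext chi g = char_ext chi' g.
  move=> fg f'g; apply/eqP/negPn/negP => xg; apply: noU.
  by exists g.
have ff' : f = f'.
  have dff : f %| f' by apply: primitive_agree_dvdp agree.
  (* Monic polynomials of equal degree, one dividing the other, are equal. *)
  by apply/eqP; rewrite -eqp_monic // -dvdp_size_eqp // fk f'k.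
case: f' / ff' chi' f'mon f'k chi'P f'sz chi'G agree {noU} => chi' *.
by rewrite (@char_ext_inj _ _ f _ _ chi chi') // => g fg; auto.
Qed.

(** Bessel's inequality for the family of all pairs of a modulus and a primitive character. Squared
    norms are at most [q ^+ (M - k)] times [euler_phi f], so multiplying through by [q ^+ (M - k)]
    leaves the weight [1 / euler_phi f]. *)
Lemma large_sieve_degree (R : realType) (F : finFieldType) (k M Q : nat)
    (a : {poly_M F} -> R[i]) : (0 < k)%N -> (k.*2 <= M)%N ->
  \sum_(f : {poly_Q.+1 F} | (val f \is monic) && (size (val f) == k.+1))
    (euler_phi (val f))%:R^-1 *
    (\sum_(chi \in @primitive_chars R F (val f))
       `|\sum_(g : {poly_M F}) a g * char_ext chi (val g)| ^+ 2)
  <= #|F|%:R ^+ (M - k) * \sum_(g : {poly_M F}) `|a g| ^+ 2.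
Proof.
move=> k_gt0 kM; set q : R[i] := #|F|%:R.
have q_gt0 : 0 < q by rewrite ltr0n; apply/card_gt0P; exists 0.
pose P (f : {poly_Q.+1 F}) := (val f \is monic) && (size (val f) == k.+1).
pose T := {f : {poly_Q.+1 F} & {ffun residue_units (val f) -> R[i]}}.
pose chars (f : {poly_Q.+1 F}) : seq {ffun residue_units (val f) -> R[i]} :=
  finmap.enum_fset (fset_set (@primitive_chars R F (val f))).
pose s : seq T := [seq Tagged _ chi | f <- enum P, chi <- chars f].
pose v (t : T) : {poly_M F} -> R[i] := conj_char (tagged t).
have dotE (t : T) :
    dotf a (v t) = \sum_(g : {poly_M F}) a g * char_ext (tagged t) (val g).
  by apply: eq_bigr => g _; rewrite /v /conj_char conjCK.
have charsP f chi : (chi \in chars f) -> primitive_char chi.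
  have fin := finite_primitive_chars R (val f).
  by rewrite (in_fset_set fin chi : (chi \in chars f) = _) inE.
have sP t : t \in s ->
    [/\ val (tag t) \is monic, size (val (tag t)) = k.+1 & primitive_char (tagged t)].
  case/allpairsPdep => f [chi [fP chiP ->]] /=.
  by move: fP; rewrite mem_enum => /andP[fmon /eqP fk]; split=> //; apply: charsP.
have s_uniq : uniq s.
  apply: allpairs_uniq_dep; rewrite ?enum_uniq //; last by move=> [f chi] [f' chi'].
  by move=> f _; apply: finmap.fset_uniq.
have vv t : t \in s -> 0 < dotf (v t) (v t) <= q ^+ (M - k) * (euler_phi (val (tag t)))%:R.
  move=> /sP[fmon fk [chiG _]]; rewrite dotf_conj_char ?fk // ltr0n.
  rewrite -natrX -natrM ler_nat (card_npoly_coprime _ fmon) // andbT.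
  (* The constant 1 is prime to every modulus and lies in the space because [0 < k.*2 <= M]. *)
  apply/card_gt0P; exists (npolyp M 1).
  by rewrite inE /= npolypK ?coprimep1 // size_poly1 (leq_trans _ kM) // double_gt0.
have orth : {in s &, forall t t', t != t' -> dotf (v t) (v t') = 0}.
  move=> [f chi] [f' chi'] /sP[/= fmon fk chiP] /sP[/= f'mon f'k chi'P] tt'.
  apply: (@primitive_chars_orthogonal _ _ k M) => // E; case/eqP: tt'.
  have ff' : f = f' by apply: val_inj; apply: (congr1 tag E).
  case: f' / ff' chi' {f'mon f'k chi'P} E => chi' /eqP.
  by rewrite eq_Tagged /= => /eqP ->.
have v0 : {in s, forall t, dotf (v t) (v t) != 0}.
  by move=> t /vv/andP[/lt0r_neq0].
have := bessel a s_uniq v0 orth.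
have -> : dotf a a = \sum_g `|a g| ^+ 2.
  by apply: eq_bigr => g _; rewrite normCK.
rewrite -(ler_pM2l (exprn_gt0 (M - k) q_gt0)); apply: le_trans.
rewrite mulr_sumr big_allpairs_dep -(big_enum _ _ P) /=.
rewrite big_seq [leRHS]big_seq; apply: ler_sum => f fP.
rewrite fsbig_finite /=; last exact: finite_primitive_chars.
rewrite mulr_sumr big_seq [leRHS]big_seq; apply: ler_sum => chi chiP.
have ts : Tagged (fun f : {poly_Q.+1 F} => {ffun residue_units (val f) -> R[i]}) chi \in s.
  by apply/allpairsPdep; exists f, chi.
have /andP[d_gt0 d_le] := vv _ ts.
have phi_gt0 : 0 < (euler_phi (val f))%:R :> R[i].
  by rewrite ltr0n; apply/card_gt0P; exists 1%g.
rewrite dotE /= [leLHS]mulrC [leRHS]mulrCA; apply: ler_wpM2l; first exact: exprn_ge0.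
by rewrite ler_pdivlMr // mulrC ler_pdivrMr.
Qed.

Lemma normr_complexE (R : realType) (z : R[i]) : `|z| = (Normc.normc z)%:C%C.
Proof. by case: z => x y; rewrite normc_def. Qed.

(* With M = max(N+1, 2k), the bound q^(M-k) is at most q^(N+1-k) + q^k. *)
Lemma large_sieve_degree_real (R : realType) (F : finFieldType) (k N Q : nat)
    (a : {poly F} -> R[i]) : (0 < k)%N ->
  \sum_(f : {poly_Q.+1 F} | (val f \is monic) && (size (val f) == k.+1))
    (euler_phi (val f))%:R^-1 *
    (\sum_(chi \in @primitive_chars R F (val f))
       Normc.normc (\sum_(g : {poly_N.+1 F} | val g \is monic)
                      a (val g) * char_ext chi (val g)) ^+ 2)
  <= (#|F|%:R ^ (N.+1%:Z - k%:Z) + #|F|%:R ^+ k) *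
     \sum_(g : {poly_N.+1 F} | val g \is monic) Normc.normc (a (val g)) ^+ 2 :> R.
Proof.
move=> k_gt0; pose M := maxn N.+1 k.*2.
have NM : (N.+1 <= M)%N by apply: leq_maxl.
have kM : (k.*2 <= M)%N by apply: leq_maxr.
pose P (g : {poly F}) := (size g <= N.+1)%N && (g \is monic).
(* [b] also vanishes on non-monic polynomials, so that sums over the whole space reduce to sums over
   monic [g] of degree at most [N]. *)
pose b (g : {poly_M F}) : R[i] := if P (val g) then a (val g) else 0.
have q_gt0 : 0 < #|F|%:R :> R by rewrite ltr0n; apply/card_gt0P; exists 0.
have sumE f chi : \sum_(g : {poly_M F}) b g * @char_ext R F f chi (val g) =
    \sum_(g : {poly_N.+1 F} | val g \is monic) a (val g) * char_ext chi (val g).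
  rewrite (sum_npoly_widen (fun g => g \is monic)
    (fun g => a g * char_ext chi g) NM) [RHS]big_mkcond.
  by apply: eq_bigr => g _; rewrite /b /P; case: ifP => // _; rewrite mul0r.
have normE : \sum_(g : {poly_M F}) `|b g| ^+ 2 =
    (\sum_(g : {poly_N.+1 F} | val g \is monic) Normc.normc (a (val g)) ^+ 2)%:C%C.
  rewrite (sum_npoly_widen (fun g => g \is monic)
    (fun g => Normc.normc (a g) ^+ 2) NM) [in RHS]big_mkcond rmorph_sum.
  apply: eq_bigr => g _; rewrite /b /P; case: ifP => _; last by rewrite normr0 expr0n.
  by rewrite rmorphXn /= normr_complexE.
set S := \sum_(g : {poly_N.+1 F} | _) _ in normE *.
have S_ge0 : 0 <= S by apply: sumr_ge0 => g _; exact: sqr_ge0.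
apply: (@le_trans _ _ (#|F|%:R ^+ (M - k) * S)).
  rewrite -lecR rmorphM rmorphXn rmorph_nat rmorph_sum /= -normE.
  apply: le_trans (large_sieve_degree Q b k_gt0 kM).
  rewrite le_eqVlt; apply/orP/or_introl/eqP/eq_bigr => f _.
  rewrite !fsbig_finite /=; [|exact: finite_primitive_chars..].
  rewrite rmorphM fmorphV rmorph_nat rmorph_sum /=; congr (_ * _).
  by apply: eq_bigr => chi _; rewrite sumE rmorphXn /= normr_complexE.
(* [M - k] is [k] in the first case and [N.+1 - k] in the second; the other summand is nonnegative,
   even when its integer exponent is negative. *)
apply: ler_wpM2r => //; rewrite /M; have [Nk|kN] := leqP N.+1 k.*2.
  by rewrite -addnn addnK lerDr exprz_ge0 // ltW.
rewrite subzn; last by rewrite (leq_trans _ (ltnW kN)) // -addnn leq_addr.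
by rewrite lerDl exprn_ge0 // ltW.
Qed.

(** * Geometric sums over the degree of the modulus *)

Section GeometricTails.
Variables (R : realFieldType) (q : R).
Hypothesis q2 : 2 <= q.

Let q_gt0 : 0 < q. Proof. exact: lt_le_trans q2. Qed.

Lemma sum_expr_le (D Q : nat) :
  \sum_(k < Q.+1 | (D < k)%N) q ^+ k <= 2 * q ^+ Q.
Proof.
elim: Q => [|Q IHQ]; rewrite big_mkcond big_ord_recr -big_mkcond /=.
  by rewrite big_ord0 add0r expr0 mulr1 ler0n.
have qQ : 0 < q ^+ Q by apply: exprn_gt0.
have step : 2 * q ^+ Q <= q ^+ Q.+1 by rewrite exprS ler_pM2r.
by case: ifP => _; nra.
Qed.

(** The subtracted term lets the induction telescope: for [q >= 2] each new term is at most the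
    difference of two consecutive powers. The [maxn] makes the bound 0 when the sum is empty. *)
Lemma sum_expVr_le (D Q : nat) :
  \sum_(k < Q.+1 | (D < k)%N) q^-1 ^+ k <= q^-1 ^+ D - q^-1 ^+ maxn D Q.
Proof.
elim: Q => [|Q IHQ]; rewrite big_mkcond big_ord_recr -big_mkcond /=.
  by rewrite big_ord0 maxn0 subrr addr0.
rewrite ltnS; have [DQ|QD] := leqP D Q; last first.
  by rewrite addr0 (maxn_idPl QD); move: IHQ; rewrite (maxn_idPl (ltnW QD)).
have step : 2 * q^-1 ^+ Q.+1 <= q^-1 ^+ Q.
  rewrite exprS mulrA; apply: ler_piMl; last by rewrite ler_pdivrMr // mul1r.
  by rewrite exprn_ge0 // invr_ge0 ltW.
rewrite (maxn_idPr (leqW DQ)).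
move: IHQ; rewrite (maxn_idPr DQ); lra.
Qed.

End GeometricTails.

(** * Summation over the degrees [D < k <= Q] *)

Theorem theorem3p5 (R : realType) (q : nat)
    (q_prime_power : exists p k : nat, [/\ prime p, (0 < k)%N & q = (p ^ k)%N]) :
  exists2 C : R, 0 < C &
    forall F : finFieldType, #|F| = q ->
    forall (D Q N : nat) (a : {poly F} -> R[i]),
      \sum_(f : {poly_Q.+1 F} | (val f \is monic) && (D < (size (val f)).-1)%N)
        (euler_phi (val f))%:R^-1 *
        (\sum_(chi \in @primitive_chars R F (val f))
           Normc.normc (\sum_(g : {poly_N.+1 F} | val g \is monic)
                    a (val g) * char_ext chi (val g)) ^+ 2)
      <= C * (q%:R ^ (N%:Z - D%:Z) + q%:R ^+ Q) *
         \sum_(g : {poly_N.+1 F} | val g \is monic) Normc.normc (a (val g)) ^+ 2.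
Proof.
(* The factor [q] comes from the exponent [N.+1] in place of [N], the 2 from [sum_expr_le]. *)
exists (q%:R + 2); first by rewrite ltr_wpDl ?ler0n.
move=> F cardF D Q N a.
set S := \sum_(g : {poly_N.+1 F} | _) _.
have S_ge0 : 0 <= S by apply: sumr_ge0 => g _; exact: sqr_ge0.
have q2 : 2 <= q%:R :> R by rewrite -cardF ler_nat card_finRing_gt1.
have q_gt0 : 0 < q%:R :> R by lra.
pose deg (f : {poly_Q.+1 F}) : 'I_Q.+1 := inord (size (val f)).-1.
have degE (f : {poly_Q.+1 F}) : deg f = (size (val f)).-1 :> nat.
  by rewrite inordK // ltnS -subn1 leq_subLR add1n size_npoly.
rewrite (partition_big deg (fun k : 'I_Q.+1 => (D < k)%N)) => [|f /andP[_]]; last first.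
  by rewrite degE.
apply: (@le_trans _ _ (\sum_(k < Q.+1 | (D < k)%N)
    (q%:R ^ (N.+1%:Z - k%:Z) + q%:R ^+ k) * S)).
  apply: ler_sum => k Dk; have k_gt0 : (0 < k)%N by apply: leq_ltn_trans Dk.
  rewrite -cardF; apply: le_trans (large_sieve_degree_real N Q a k_gt0).
  rewrite le_eqVlt; apply/orP/or_introl/eqP/eq_bigl => f.
  rewrite -andbA -val_eqE /= degE; congr (_ && _).
  have [->|fk] := eqVneq (size (val f)) k.+1; first by rewrite Dk eqxx.
  (* [D < (size f).-1] excludes size 0, so the predecessor can be undone. *)
  apply/negP => /andP[Df /eqP sf]; move: fk; rewrite -sf prednK ?eqxx //.
  by move: Df; case: size.
rewrite -mulr_suml ler_wpM2r // big_split /=.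
have -> : \sum_(k < Q.+1 | (D < k)%N) q%:R ^ (N.+1%:Z - k%:Z) =
    q%:R ^+ N.+1 * \sum_(k < Q.+1 | (D < k)%N) q%:R^-1 ^+ k :> R.
  rewrite mulr_sumr; apply: eq_bigr => k _.
  by rewrite expfzDr ?gt_eqF // exprnP exprVn exprnN.
have -> : q%:R ^ (N%:Z - D%:Z) = q%:R ^+ N * q%:R^-1 ^+ D :> R.
  by rewrite expfzDr ?gt_eqF // exprnP exprVn exprnN.
have t1 := sum_expr_le q2 D Q.
have t2 : q%:R ^+ N.+1 * \sum_(k < Q.+1 | (D < k)%N) q%:R^-1 ^+ k
    <= q%:R * (q%:R ^+ N * q%:R^-1 ^+ D) :> R.
  rewrite mulrA -exprS ler_pM2l ?exprn_gt0 //.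
  apply: le_trans (sum_expVr_le q2 D Q) _.
  by rewrite gerBl exprn_ge0 // invr_ge0 ltW.
have x_ge0 : 0 <= q%:R ^+ N * q%:R^-1 ^+ D :> R.
  by rewrite mulr_ge0 ?exprn_ge0 // invr_ge0 ltW.
have y_ge0 : 0 <= q%:R ^+ Q :> R by rewrite exprn_ge0 // ltW.
nra.
Qed.
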